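(* Let $p$ be an odd prime and $r\ge1$ an integer. Then $$\sum_{k=0}^{p^r-1}(3k+1)\frac{(\frac12)_k^3}{(1)_k^3}4^k\equiv\sum_{k=0}^{(p^r-1)/2}(4k+1)\frac{(\frac12)_k^4}{(1)_k^4}\pmod{p^{r+4}}.$$
   Context: $(x)_k=x(x+1)\cdots(x+k-1)$ is the Pochhammer symbol, with $(x)_0=1$. A congruence $a\equiv b\pmod{p^m}$ between rational numbers means that $(a-b)/p^m$ is a rational number whose denominator is not divisible by $p$. *)

(* Defs.v *)
From mathcomp Require Import all_boot all_order all_algebra.
Set Implicit Arguments. Unset Strict Implicit. Unset Printing Implicit Defensive.
Import Order.TTheory GRing.Theory Num.Theory.
Local Open Scope ring_scope.

Definition poch (x : rat) (k : nat) : rat := \prod_(i < k) (x + i%:R).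

Definition rat_cong_mod (p m : nat) (a b : rat) : Prop :=
  ~~ (p%:Z %| denq ((a - b) / (p ^ m)%:R))%Z.

(* Main.v *)
(* Write n = p^r = 2m + 1. Two WZ pairs telescope both truncated sums exactly into sums over 0 <= i <= m
   of hypergeometric terms a_i and b_i with a_0 = b_0 = n * prod_(1 <= i <= m) (1 - n^2 / (4 i^2)) and
     a_i / a_0 = (n/2)_i^2 (-n/2)_i / (i! (1/2)_i ((1+n)/2)_i),
     b_i / b_0 = (-n/2)_i^3 / (i! (1/2-n)_i ((1-n)/2)_i).
   For i >= 1 the factor n^3 / i^3 hidden in these ratios, together with the bound on the p-adic valuation of
   i 'C(N, i) for N < n, shows that p^(r+3) divides a_i, while b_i / a_i is a product of quotients which are
   all 1 modulo p. Hence the two sums agree modulo p^(r+4) term by term. *)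
Require Import Defs.
From mathcomp Require Import all_boot all_order all_algebra.
From mathcomp Require Import ring lra zify.
Import Order.TTheory GRing.Theory Num.Theory.
Local Open Scope ring_scope.

(** * Pochhammer symbols and reciprocal factorials *)

Lemma pochS x k : poch x k.+1 = poch x k * (x + k%:R).
Proof. by rewrite /poch big_ord_recr. Qed.

Lemma poch0 x : poch x 0 = 1.
Proof. by rewrite /poch big_ord0. Qed.

Lemma poch1 k : poch 1 k = k`!%:R.
Proof.
elim: k => [|k IH]; first by rewrite poch0.
by rewrite pochS IH factS natrM mulrC -natr1 addrC.
Qed.

Lemma poch_gt0 x k : 0 < x -> 0 < poch x k.
Proof. by move=> x0; apply: prodr_gt0 => i _; rewrite ltr_pwDl ?ler0n. Qed.

Local Notation H := (poch (1 / 2)).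

Lemma poch_half_neq0 k : H k != 0.
Proof. by rewrite gt_eqF ?poch_gt0. Qed.

Lemma factr_neq0 k : k`!%:R != 0 :> rat.
Proof. by rewrite pnatr_eq0 -lt0n fact_gt0. Qed.

Lemma factSr k : k.+1`!%:R = (k%:R + 1) * k`!%:R :> rat.
Proof. by rewrite factS natrM -natr1. Qed.

(* [1 / (N - k)!], with the convention that it vanishes for [k > N]: this makes the WZ relations hold without
   boundary cases. *)
Definition rfact (N k : nat) : rat := if (k <= N)%N then (N - k)`!%:R^-1 else 0.

Lemma rfactSS N k : rfact N.+1 k.+1 = rfact N k.
Proof. by rewrite /rfact ltnS subSS. Qed.

Lemma rfactS N k : rfact N k.+1 = (N%:R - k%:R) * rfact N k.
Proof.
rewrite /rfact; case: (ltngtP k N) => [kN|kN|->]; last by rewrite subrr mul0r.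
  rewrite -natrB; last exact: ltnW.
  have [q ->] : exists q, N = (k + q.+1)%N by exists (N - k.+1)%N; lia.
  rewrite addKn (_ : k + q.+1 - k.+1 = q)%N; last by lia.
  have := factr_neq0 q; rewrite factSr -natr1; have : (q%:R + 1 : rat) != 0 by rewrite natr1 pnatr_eq0.
  by move=> q0 f0; field; apply/andP.
by rewrite mulr0.
Qed.

Lemma rfact_small N k : (N < k)%N -> rfact N k = 0.
Proof. by rewrite /rfact ltnNge => /negbTE ->. Qed.

(** * WZ pairs and exact telescoping of both sums *)

(** Summing the relation over [k < N] collapses its right side to [G N j], so each step in [j]
    trades the sum of [F k j] for [c j] times that of [F k j.+1] plus one boundary term. The weights
    [c] let the pair stay free of normalising products in [j]. *)
Lemma wz_sum (F G : nat -> nat -> rat) (c : nat -> rat) (N J : nat) :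
    (forall j k, F k j - c j * F k j.+1 = G k.+1 j - G k j) ->
    (forall j, G 0%N j = 0) ->
  \sum_(0 <= k < N) F k 0%N =
  \sum_(0 <= j < J) (\prod_(l < j) c l) * G N j
    + (\prod_(l < J) c l) * \sum_(0 <= k < N) F k J.
Proof.
move=> FG G0; elim: J => [|J IH]; first by rewrite [\sum_(0 <= j < 0) _]big_geq // big_ord0 mul1r add0r.
rewrite IH big_nat_recr //= big_ord_recr /= -addrA; congr (_ + _).
rewrite -mulrA -mulrDr; congr (_ * _).
apply/eqP; rewrite -subr_eq mulr_sumr -sumrB; apply/eqP.
under eq_bigr do rewrite FG.
by rewrite telescope_sumr // G0 subr0.
Qed.

(** At [j = 0] this is the first summand, since [rfact k 0] is 1 / k!. The truncated [k - j] is
    harmless because [rfact k j.*2] vanishes for k < 2j. [GA] is the WZ mate. *)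
Definition FA (k j : nat) : rat :=
  (3 * k%:R - 2 * j%:R + 1) * H (k - j) ^+ 2 * H k * 4 ^+ k * rfact k j.*2
  / ((k - j)`!%:R * k`!%:R).
Definition GA (N j : nat) : rat :=
  N%:R ^+ 2 * (N%:R - j%:R) * H (N - j.+1) ^+ 2 * H N * 4 ^+ N * rfact N j.*2.+1
  / (2 * (2 * j%:R + 1) * ((N - j)`!%:R * N`!%:R)).

Lemma odd_neq0 j : 2 * j%:R + 1 != 0 :> rat.
Proof. by rewrite gt_eqF // ltr_wpDl // mulr_ge0. Qed.

Lemma wz_A j k :
  FA k j - (- (2 * (2 * j%:R + 1))^-1) * FA k j.+1 = GA k.+1 j - GA k j.
Proof.
have j0 := odd_neq0 j.
rewrite /FA /GA doubleS rfactSS !rfactS.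
have [kj|kj] := ltnP k j.*2.
  by rewrite rfact_small // !(mulr0, mul0r) subrr.
(* From k >= 2j, either k > j, or k = j = 0, where [k - j.+1] is truncated and a separate check is
   needed. *)
have [[k0 jz]|[q kq]] : (k = 0 /\ j = 0)%N \/ exists q, (k = j + q.+1)%N.
- case E: (k - j)%N => [|q]; [left | right; exists q]; lia.
- subst k j; rewrite /rfact pochS !poch0 /= !factS !fact0 double0 !muln1 /=. by field.
move: (rfact k j.*2) => R; subst k => {kj}.
have -> : ((j + q.+1).+1 - j = q.+2)%N by lia.
have -> : ((j + q.+1).+1 - j.+1 = q.+1)%N by lia.
have -> : (j + q.+1 - j = q.+1)%N by lia.
have -> : (j + q.+1 - j.+1 = q)%N by lia.
rewrite addnS !pochS !factSr !exprS -muln2 !natrM !natrD.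
have := factr_neq0 q; have := factr_neq0 (j + q).
move: (H q) (H (j + q)) (4 ^+ (j + q)) (q`!%:R) ((j + q)`!%:R).
move=> hq hk e fq fk fk0 fq0.
have := ler0n rat j; have := ler0n rat q => qge jge.
by field; rewrite fk0 fq0 /= !gt_eqF //; lra.
Qed.

(** At [j = 0] this is the second summand; [GB] is the WZ mate. *)
Definition FB (k j : nat) : rat :=
  (4 * k%:R + 1) * H k ^+ 3 * H (k + j) * rfact k j / k`!%:R ^+ 3.
Definition GB (N j : nat) : rat :=
  16 * N%:R ^+ 3 * H N ^+ 3 * H (N + j) * rfact N j.+1
  / ((2 * j%:R + 1) ^+ 3 * N`!%:R ^+ 3).

Lemma wz_B j k :
  FB k j - (- 8 * (j%:R + 1) / (2 * j%:R + 1) ^+ 3) * FB k j.+1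
  = GB k.+1 j - GB k j.
Proof.
have j0 := odd_neq0 j.
rewrite /FB /GB rfactSS !rfactS addnS addSn !pochS !factSr natrD.
have := factr_neq0 k.
move: (rfact k j) (H k) (H (k + j)) (k`!%:R) => R hk hkj fk fk0.
have := ler0n rat j; have := ler0n rat k => kge jge.
by field; rewrite fk0 /= !gt_eqF //; lra.
Qed.

Lemma sum_A m :
  \sum_(0 <= k < m.*2.+1)
     (3 * k%:R + 1) * (poch (1/2) k ^+ 3 / poch 1 k ^+ 3) * 4 ^+ k
  = \sum_(0 <= j < m.+1)
     (\prod_(l < j) (- (2 * (2 * l%:R + 1))^-1)) * GA m.*2.+1 j.
Proof.
have := @wz_sum FA GA (fun l => - (2 * (2 * l%:R + 1))^-1) m.*2.+1 m.+1 wz_A.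
(* After m + 1 steps nothing is left of the sum: [rfact k m.+1.*2] is 0 for k <= 2m. *)
have -> : \sum_(0 <= k < m.*2.+1) FA k m.+1 = 0.
  rewrite big_nat_cond big1 // => k; rewrite andbT => /andP [_ km].
  by rewrite /FA rfact_small ?mulr0 ?mul0r //; lia.
rewrite mulr0 addr0 => <-; last by move=> j; rewrite /GA expr0n !mul0r.
apply: eq_bigr => k _; rewrite /FA /rfact poch1 double0 leq0n !subn0.
by field; rewrite factr_neq0.
Qed.

Lemma sum_B m :
  \sum_(0 <= k < m.+1)
     (4 * k%:R + 1) * (poch (1/2) k ^+ 4 / poch 1 k ^+ 4)
  = \sum_(0 <= j < m.+1)
     (\prod_(l < j) (- 8 * (l%:R + 1) / (2 * l%:R + 1) ^+ 3)) * GB m.+1 j.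
Proof.
have := @wz_sum FB GB (fun l => - 8 * (l%:R + 1) / (2 * l%:R + 1) ^+ 3) m.+1 m.+1 wz_B.
have -> : \sum_(0 <= k < m.+1) FB k m.+1 = 0.
  rewrite big_nat_cond big1 // => k; rewrite andbT => /andP [_ km].
  by rewrite /FB rfact_small ?mulr0 ?mul0r //; lia.
rewrite mulr0 addr0 => <-; last by move=> j; rewrite /GB expr0n mulr0 !mul0r.
apply: eq_bigr => k _; rewrite /FB /rfact poch1 addn0 leq0n subn0.
by field; rewrite factr_neq0.
Qed.

(** * Closed forms and ratios of the boundary terms *)

(* The boundary terms of the WZ telescoping, listed from [j = m] downwards so that the leading one is [i = 0]. *)
Definition termA (m i : nat) : rat :=
  (\prod_(l < m - i) (- (2 * (2 * l%:R + 1))^-1)) * GA m.*2.+1 (m - i).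
Definition termB (m i : nat) : rat :=
  (\prod_(l < m - i) (- 8 * (l%:R + 1) / (2 * l%:R + 1) ^+ 3)) * GB m.+1 (m - i).

Lemma prodA j : \prod_(l < j) (- (2 * (2 * l%:R + 1))^-1) = (-1) ^+ j / (4 ^+ j * H j).
Proof.
elim: j => [|j IH]; first by rewrite big_ord0 poch0.
rewrite big_ord_recr /= IH pochS !exprS.
have := poch_half_neq0 j; have := odd_neq0 j; have := ler0n rat j.
have : 4 ^+ j != 0 :> rat by rewrite expf_neq0.
move: (4 ^+ j) (H j) => e h e0 jge j0 h0.
by field; rewrite h0 e0 /= !gt_eqF //; lra.
Qed.

Lemma prodB j :
  \prod_(l < j) (- 8 * (l%:R + 1) / (2 * l%:R + 1) ^+ 3) = (-1) ^+ j * j`!%:R / H j ^+ 3 :> rat.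
Proof.
elim: j => [|j IH]; first by rewrite big_ord0 poch0 fact0; field.
rewrite big_ord_recr /= IH pochS factSr [(-1) ^+ j.+1]exprS.
have := poch_half_neq0 j; have := odd_neq0 j; have := ler0n rat j.
move: (H j) => h jge j0 h0.
by field; rewrite h0 /= !gt_eqF //; lra.
Qed.

(** Trades (1/2)_k for a central binomial coefficient, so that divisibility questions become
    questions about integers. *)
Lemma poch_half_bin k : 4 ^+ k * H k = k`!%:R * 'C(k.*2, k)%:R.
Proof.
have -> : 'C(k.*2, k)%:R = k.*2`!%:R / k`!%:R ^+ 2 :> rat.
  have /(congr1 (fun x => x%:R : rat)) := @bin_fact k.*2 k ltac:(lia).
  rewrite (_ : k.*2 - k = k)%N; last by lia.
  by rewrite !natrM => <-; field; rewrite factr_neq0.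
elim: k => [|k IH]; first by rewrite poch0 double0 fact0; field.
transitivity (4 ^+ k * H k * (4 * (1 / 2 + k%:R))).
  by rewrite pochS exprS; ring.
rewrite {}IH doubleS !factSr -muln2.
have := ler0n rat k; have := factr_neq0 k => k0 kge.
by field; rewrite k0 /= !gt_eqF //; lra.
Qed.

(** The closed form is the same as in [termB0]: the leading terms cancel in the difference of the
    two sums. *)
Lemma termA0 m : termA m 0 = 2 * (-1) ^+ m * H m.*2.+1 / m`!%:R ^+ 2.
Proof.
rewrite /termA prodA /GA /rfact !subn0 leqnn subnn fact0.
rewrite (_ : m.*2.+1 - m.+1 = m)%N; last by lia.
rewrite (_ : m.*2.+1 - m = m.+1)%N; last by lia.
have -> : m.*2.+1`!%:R = (2 * m%:R + 1) * (4 ^+ m * H m * m`!%:R) :> rat.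
  rewrite poch_half_bin factSr -muln2 natrM; congr (_ * _); first by ring.
  have /(congr1 (fun x => x%:R : rat)) := @bin_fact m.*2 m ltac:(lia).
  rewrite (_ : m.*2 - m = m)%N; last by lia.
  by rewrite !natrM muln2 => <-; ring.
have -> : 4 ^+ m.*2.+1 = 4 * (4 ^+ m) ^+ 2 :> rat by rewrite exprS -muln2 exprM.
have := poch_half_neq0 m; have := factr_neq0 m; rewrite factSr -muln2.
have : 4 ^+ m != 0 :> rat by rewrite expf_neq0.
have := ler0n rat m.
move: (4 ^+ m) (H m) (m`!%:R) => e h f mge e0 f0 h0.
by field; rewrite h0 f0 e0 /= !gt_eqF //; lra.
Qed.

Lemma termB0 m : termB m 0 = 2 * (-1) ^+ m * H m.*2.+1 / m`!%:R ^+ 2.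
Proof.
rewrite /termB prodB /GB /rfact !subn0 leqnn subnn fact0 addSn addnn !pochS factSr.
have := poch_half_neq0 m; have := factr_neq0 m.
have := ler0n rat m.
move: (H m) (m`!%:R) => h f mge f0 h0.
by rewrite -muln2 natrM; field; rewrite h0 f0 /= !gt_eqF //; lra.
Qed.

Lemma termA_rec m i : (i < m)%N ->
  termA m i.+1 = termA m i * ((m%:R + 1 / 2 + i%:R) ^+ 2 * (i%:R - m%:R - 1 / 2)
    / ((i%:R + 1) * (i%:R + 1 / 2) * (m%:R + 1 + i%:R))).
Proof.
(* With j = m - i - 1, the truncated subtractions become sums, and [termA m i] has just one more
   product factor than [termA m i.+1]. *)
move=> im; have [j ->] : exists j, m = (j + i).+1 by exists (m - i.+1)%N; lia.
rewrite /termA (_ : (j + i).+1 - i.+1 = j)%N; last by lia.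
rewrite (_ : (j + i).+1 - i = j.+1)%N; last by lia.
rewrite big_ord_recr /=; set r := (X in _ = _ * X).
suff -> : GA (j + i).+1.*2.+1 j
    = - (2 * (2 * j%:R + 1))^-1 * GA (j + i).+1.*2.+1 j.+1 * r by rewrite !mulrA.
rewrite {}/r.
rewrite /GA /rfact.
rewrite (_ : j.+1.*2 < (j + i).+1.*2.+1)%N; last by lia.
rewrite (_ : j.*2 < (j + i).+1.*2.+1)%N; last by lia.
rewrite (_ : (j + i).+1.*2.+1 - j.+2 = j + i.*2.+1)%N; last by lia.
rewrite (_ : (j + i).+1.*2.+1 - j.+1 = (j + i.*2.+1).+1)%N; last by lia.
rewrite (_ : (j + i).+1.*2.+1 - j = (j + i.*2.+1).+2)%N; last by lia.
rewrite (_ : (j + i).+1.*2.+1 - j.+1.*2.+1 = i.*2)%N; last by lia.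
rewrite (_ : (j + i).+1.*2.+1 - j.*2.+1 = i.*2.+2)%N; last by lia.
rewrite !(factSr (j + i.*2.+1).+1) !(factSr (j + i.*2.+1)) (factSr i.*2.+1) (factSr i.*2).
rewrite [H (j + i.*2.+1).+1]pochS.
have := factr_neq0 (j + i.*2.+1); have := factr_neq0 (i.*2).
have := factr_neq0 ((j + i).+1.*2.+1).
move: (H (j + i.*2.+1)) ((j + i.*2.+1)`!%:R) (i.*2`!%:R) => h f g.
move: (H _) (4 ^+ _) (_`!%:R) => h2 e f2 f20 g0 f0.
rewrite -!muln2.
have := ler0n rat j; have := ler0n rat i => ige jge.
by field; rewrite f20 f0 g0 /= !gt_eqF //; lra.
Qed.

Lemma termB_rec m i : (i < m)%N ->
  termB m i.+1 = termB m i * ((i%:R - m%:R - 1 / 2) ^+ 3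
    / ((i%:R + 1) * (i%:R - 2 * m%:R - 1 / 2) * (i%:R - m%:R))).
Proof.
move=> im; have [j ->] : exists j, m = (j + i).+1 by exists (m - i.+1)%N; lia.
rewrite /termB (_ : (j + i).+1 - i.+1 = j)%N; last by lia.
rewrite (_ : (j + i).+1 - i = j.+1)%N; last by lia.
rewrite big_ord_recr /=; set r := (X in _ = _ * X).
suff -> : GB (j + i).+2 j
    = - 8 * (j%:R + 1) / (2 * j%:R + 1) ^+ 3 * GB (j + i).+2 j.+1 * r by rewrite !mulrA.
rewrite {}/r.
rewrite /GB /rfact.
rewrite (_ : j.+1 < (j + i).+2)%N; last by lia.
rewrite (_ : j < (j + i).+2)%N; last by lia.
rewrite (_ : (j + i).+2 - j.+2 = i)%N; last by lia.
rewrite (_ : (j + i).+2 - j.+1 = i.+1)%N; last by lia.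
rewrite addnS [H (_ + j).+1]pochS (factSr i).
have := factr_neq0 (j + i).+2; have := factr_neq0 i.
move: (H (_ + j)) (H _) (i`!%:R) ((j + i).+2`!%:R) => h h2 f f2 f0 f20.

have := ler0n rat j; have := ler0n rat i => ige jge.
field; do 2![rewrite lt_eqF; last by lra].
by rewrite f20 f0 /= !gt_eqF //; lra.
Qed.

(** * Divisibility by powers of p among rationals *)

(** For p prime, this says that the p-adic valuation of [x] is at least [e]. The fraction need not
    be reduced, so sums and products just combine witnesses. *)
Definition pdvd (p e : nat) (x : rat) : Prop :=
  exists a b : int, coprimez p b /\ x * b%:~R = a%:~R * p%:R ^+ e.

Section Padic.

Context (p : nat).
Context (p_prime : prime p).

Lemma coprimez_neq0 (b : int) : coprimez p b -> b%:~R != 0 :> rat.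
Proof.
rewrite intr_eq0; apply: contraTneq => ->.
by rewrite coprimezE prime_coprime // dvdn0.
Qed.

Lemma pdvd_int z : pdvd p 0 z%:~R.
Proof. by exists z, 1; rewrite coprimezE coprimen1 expr0. Qed.

Lemma pdvd_nat k : pdvd p 0 k%:R.
Proof. by rewrite pmulrn; apply: pdvd_int. Qed.

Lemma pdvd_invn b : coprime p b -> pdvd p 0 b%:R^-1.
Proof.
move=> pb; exists 1, b; rewrite coprimezE; split => //.
by rewrite expr0 mulr1 mulVf // pmulrn coprimez_neq0 ?coprimezE.
Qed.

Lemma pdvdD e x y : pdvd p e x -> pdvd p e y -> pdvd p e (x + y).
Proof.
move=> [a [b [pb xb]]] [c [d [pd yd]]]; exists (a * d + c * b), (b * d).
rewrite coprimezMr pb pd; split=> //.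
rewrite !(intrD, intrM) mulrDl mulrA xb (mulrC b%:~R) mulrA yd; ring.
Qed.

Lemma pdvdN e x : pdvd p e x -> pdvd p e (- x).
Proof.
move=> [a [b [pb xb]]]; exists (- a), b; split=> //.
by rewrite mulNr xb rmorphN mulNr.
Qed.

Lemma pdvdM e f x y : pdvd p e x -> pdvd p f y -> pdvd p (e + f) (x * y).
Proof.
move=> [a [b [pb xb]]] [c [d [pd yd]]]; exists (a * c), (b * d).
rewrite coprimezMr pb pd; split=> //.
by rewrite !intrM mulrACA xb yd exprD mulrACA.
Qed.

Lemma pdvdMl e x y : pdvd p 0 x -> pdvd p e y -> pdvd p e (x * y).
Proof. exact: pdvdM. Qed.

Lemma pdvdW e f x : (f <= e)%N -> pdvd p e x -> pdvd p f x.
Proof.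
move=> fe [a [b [pb xb]]]; exists (a * p%:Z ^+ (e - f)), b; split=> //.
by rewrite xb intrM rmorphXn /= pmulrn -mulrA -exprD subnK.
Qed.

Lemma pdvd_sum e (I : Type) (s : seq I) (P : pred I) (F : I -> rat) :
  (forall i, P i -> pdvd p e (F i)) -> pdvd p e (\sum_(i <- s | P i) F i).
Proof.
move=> PF; apply: big_rec => [|i x Pi]; last by apply: pdvdD; apply: PF.
by exists 0, 1; rewrite coprimezE coprimen1 !mul0r.
Qed.

(** The reduced denominator of (x - y) / p^e divides the witness [b], which is prime to p. *)
Lemma rat_cong_modP e x y : pdvd p e (x - y) -> rat_cong_mod p e x y.
Proof.
move=> [a [b [pb xb]]]; rewrite /rat_cong_mod; set z := _ / _.
have p0 : p%:R != 0 :> rat by rewrite pnatr_eq0 -lt0n prime_gt0.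
have zb : z * b%:~R = a%:~R.
  by rewrite /z mulrAC xb natrX mulfK // expf_neq0.
have d0 : (denq z)%:~R != 0 :> rat by rewrite intr_eq0 denq_neq0.
have /eqP : numq z * b = a * denq z.
  apply: (@intr_inj rat); rewrite !intrM -zb -{2}(divq_num_den z).
  by rewrite mulrAC divfK.
apply: contraTN => pz; apply/negP => /eqP nb.
have : (p %| b)%Z.
  have : (denq z %| numq z * b)%Z by rewrite nb dvdz_mull.
  rewrite Gauss_dvdzr ?coprimezE; first exact: dvdz_trans.
  by rewrite coprime_sym coprime_num_den.
move: pb; rewrite coprimezE prime_coprime // dvdzE /= => /negP pb /pb //.
Qed.

Definition cong1 x := pdvd p 1 (x - 1).

Lemma cong1_1 : cong1 1.
Proof. by exists 0, 1; rewrite coprimezE coprimen1 subrr !mul0r. Qed.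

Lemma cong1_1D x : pdvd p 1 x -> cong1 (1 + x).
Proof. by rewrite /cong1 addrAC subrr add0r. Qed.

Lemma cong1_1B x : pdvd p 1 x -> cong1 (1 - x).
Proof. by move=> /pdvdN; apply: cong1_1D. Qed.

Lemma cong1_0 x : cong1 x -> pdvd p 0 x.
Proof.
move=> /(pdvdW _ _ _ (leq0n _)) h; rewrite -(subrK 1 x).
by apply: pdvdD => //; apply: (pdvd_nat 1).
Qed.

Lemma cong1M x y : cong1 x -> cong1 y -> cong1 (x * y).
Proof.
move=> hx hy; rewrite /cong1 (_ : _ - 1 = x * (y - 1) + (x - 1)); last by ring.
by apply: pdvdD => //; apply: pdvdMl => //; apply: cong1_0.
Qed.

Lemma cong1X x k : cong1 x -> cong1 (x ^+ k).
Proof.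
move=> hx; elim: k => [|k IH]; [exact: cong1_1 | by rewrite exprS; apply: cong1M].
Qed.

Lemma cong1V x : cong1 x -> cong1 x^-1.
Proof.
move=> [a [b [pb xb]]].
have b0 := coprimez_neq0 _ pb.
(* Here x = (a p + b) / b, so x^-1 - 1 = - a p / (a p + b), whose denominator is again prime to
   p. *)
have pc : coprimez p (a * p + b) by rewrite /coprimez gcdzMDl.
have c0 := coprimez_neq0 _ pc.
have xE : x = (a * p + b)%:~R / b%:~R.
  apply: (mulIf b0); rewrite divfK // intrD intrM -[p%:~R]/(p%:R) -[p%:R]expr1 -xb; ring.
exists (- a), (a * p + b); split=> //.
rewrite xE invf_div mulrBl divfK // mul1r intrD intrM rmorphN /= expr1; ring.
Qed.

End Padic.

(** * Boundary terms modulo powers of p, for n = p^r *)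

Section PrimePower.

Context (p r m : nat).
Context (p_prime : prime p) (p_odd : odd p) (pr : (p ^ r = m.*2.+1)%N).

Local Notation n := (m.*2.+1%:R : rat).

Lemma pdvd_prime_power e : pdvd p e (p ^ e)%:R.
Proof. by exists 1, 1; rewrite coprimezE coprimen1 natrX mul1r mulr1. Qed.

Lemma pdvd_half : pdvd p 0 2^-1.
Proof. by apply: pdvd_invn => //; rewrite coprimen2. Qed.

(** As l < p^r, the valuation v of l is below r, and n / l keeps the factor p^(r - v). *)
Lemma pdvd_quot l : (0 < l < p ^ r)%N -> pdvd p 1 (n / l%:R).
Proof.
move=> /andP [l0 ln].
have [q pq lE] := pfactor_coprime p_prime l0.
set v := logn p l in lE.
have vr : (v < r)%N.
  rewrite -(ltn_exp2l v r (prime_gt1 p_prime)); apply: leq_ltn_trans ln.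
  by rewrite lE leq_pmull // lt0n; apply: contraTneq l0 => q0; rewrite lE q0.
have -> : n / l%:R = q%:R^-1 * (p ^ (r - v))%:R.
  have p0 : (p ^ v)%:R != 0 :> rat by rewrite pnatr_eq0 -lt0n expn_gt0 prime_gt0.
  have q0 : q%:R != 0 :> rat.
    by rewrite pnatr_eq0; apply: contraTneq l0 => q0; rewrite lE q0.
  rewrite -pr -(subnK (ltnW vr)) expnD lE !natrM.
  rewrite subnK; last exact: ltnW.
  by field; rewrite p0 q0.
apply: pdvdMl; first exact: pdvd_invn.
apply: pdvdW (pdvd_prime_power _) => //; lia.
Qed.

(* The Leibniz harmonic triangle: [1 / (k 'C(N, k))] is an integer combination of the [1 / l], [l <= N]. *)
Lemma pdvd_leibniz k N : (k < N < p ^ r)%N -> pdvd p 1 (n / (k.+1%:R * 'C(N, k.+1)%:R)).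
Proof.
elim: k N => [|k IH] [|N] // kN; first by rewrite bin1 mul1r; apply: pdvd_quot.
set y : rat := k.+2%:R * 'C(N.+1, k.+2)%:R.
have y0 : y != 0 by rewrite mulf_neq0 // pnatr_eq0 -lt0n ?bin_gt0; lia.
have N1 : 'C(N, k.+1)%:R = y / N.+1%:R.
  have /(congr1 (fun z => z%:R : rat)) := mul_bin_diag N.+1 k.+1.
  rewrite !natrM -/y => <-; have := ler0n rat N => Nge.
  by field; rewrite gt_eqF //; lra.
have Nk : 'C(N.+1, k.+1)%:R = y / (N%:R - k%:R).
  have /(congr1 (fun z => z%:R : rat)) := mul_bin_left N.+1 k.+1.
  have kN' : (k < N)%N by lia.
  rewrite !natrM -/y subSS natrB => [->|]; last exact: ltnW.
  by field; rewrite subr_eq0 eqr_nat; lia.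
(* The recurrence of the triangle: with L(N, k) = 1 / (k 'C(N, k)), L(N+1, k+2) = L(N, k+1) - L(N+1,
   k+1). *)
have -> : n / y = n / (k.+1%:R * 'C(N, k.+1)%:R) - n / (k.+1%:R * 'C(N.+1, k.+1)%:R).
  rewrite N1 Nk; have := ler0n rat k; have := ler0n rat N => Nge kge.
  have Nk0 : k%:R < N%:R :> rat by rewrite ltr_nat; lia.
  by field; rewrite y0 /= !gt_eqF //; lra.
by apply: pdvdD; last apply: pdvdN; apply: IH; lia.
Qed.

(** (1/2)_n contains n! = n (2m)!, and (2m)! / m!^2 is a binomial coefficient. One factor n = p^r
    remains, over a power of 4, which is prime to p. *)
Lemma termA0_pdvd : pdvd p r (termA m 0).
Proof.
have -> : termA m 0
    = 2 * (-1) ^+ m * 'C(m.*2, m)%:R * 'C(m.*2.+1.*2, m.*2.+1)%:R * (4 ^ m.*2.+1)%:R^-1 * n.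
  have e0 : 4 ^+ m.*2.+1 != 0 :> rat by rewrite expf_neq0.
  have HE : H m.*2.+1 = m.*2.+1`!%:R * 'C(m.*2.+1.*2, m.*2.+1)%:R / 4 ^+ m.*2.+1.
    by rewrite -poch_half_bin [4 ^+ _ * _]mulrC mulfK.
  rewrite termA0 HE natrX factS natrM.
  have /(congr1 (fun z => z%:R : rat)) := @bin_fact m.*2 m ltac:(lia).
  rewrite (_ : m.*2 - m = m)%N; last by lia.
  rewrite !natrM => <-; move: e0 (factr_neq0 m); move: (4 ^+ _) => e e0 f0.
  by field; rewrite e0 f0.
have sgn : pdvd p 0 ((-1) ^+ m).
  have -> : (-1) ^+ m = ((-1) ^+ m)%:~R :> rat by rewrite rmorphXn rmorphN1.
  exact: pdvd_int.
apply: pdvdMl; last by rewrite -pr; apply: pdvd_prime_power.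
have pow4 : coprime p (4 ^ m.*2.+1) by apply/coprimeXr/(@coprimeXr 2 p 2); rewrite coprimen2.
apply: pdvdMl; last exact: pdvd_invn.
by do 2![apply: pdvdMl; last exact: pdvd_nat]; apply: pdvdMl sgn; apply: (pdvd_nat p 2).
Qed.

(* Here [n / 2 = m + 1 / 2]: the recurrence [termA_rec] is that of [(n/2)_i^2 (-n/2)_i / (i! (1/2)_i (m+1)_i)],
   with each [n/2 + l] rewritten as [l (1 + n / (2 l))]. *)
Lemma termA_closed i : (i < m)%N -> let k := i.+1 in
  termA m k = termA m 0 * - (1 / 8)
    * (\prod_(l < i) ((1 + n / (2 * l.+1%:R)) ^+ 2 * (1 - n / (2 * l.+1%:R))))
    * (n / k%:R) ^+ 3 * (k`!%:R / H k) * (k`!%:R * m`!%:R / (m + k)`!%:R).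
Proof.
move=> /=; elim: i => [|i IH] im.
  (* The factors with l = 0 give (n/2)^2 (-n/2) = - n^3 / 8, the source of the constant and of the
     cube. *)
  rewrite termA_rec // big_ord0 -muln2 addn1 !factSr fact0 pochS poch0.
  have := factr_neq0 m; have := ler0n rat m => mge m0.
  by field; rewrite m0 /= gt_eqF //; lra.
rewrite termA_rec // IH; last by lia.
rewrite big_ord_recr /= (addnS m i.+1) -muln2 !(factSr i.+1) (factSr (m + i.+1)) (pochS _ i.+1).
have := factr_neq0 (m + i.+1); have := factr_neq0 i.+1; have := poch_half_neq0 i.+1.
move: (\prod_(l < i) _) (termA m 0) (H i.+1) (i.+1`!%:R) (m`!%:R) ((m + i.+1)`!%:R).
move=> P T h f g e h0 f0 e0.
have := ler0n rat m; have := ler0n rat i => ige mge.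
by field; rewrite h0 e0 /= !gt_eqF //; lra.
Qed.

Lemma pdvd_half_quot l : (0 < l < p ^ r)%N -> pdvd p 1 (n / (2 * l%:R)).
Proof.
move=> ln; rewrite invfM mulrCA; apply: pdvdMl; first exact: pdvd_half.
exact: pdvd_quot.
Qed.

Lemma termA_pdvd i : (0 < i <= m)%N -> pdvd p (r + 3) (termA m i).
Proof.
case: i => // i /= im; rewrite termA_closed //.
set k := i.+1; set P := \prod_(l < i) _.
have hP : pdvd p 0 P.
  apply: cong1_0; rewrite /P; elim/big_ind: _ => [|x y|l _].
  - exact: cong1_1.
  - exact: cong1M.
  - have hl : (0 < l.+1 < p ^ r)%N by have := ltn_ord l; lia.
    apply: cong1M; first apply: cong1X.
    + exact/cong1_1D/pdvd_half_quot.
    + exact/cong1_1B/pdvd_half_quot.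
(* The ratios of factorials are 4^k / 'C(2k, k) and 1 / 'C(m + k, k). One of the three factors n / k
   goes to each binomial and one stays alone; each group yields a factor p, since 2k and m + k are
   below n. *)
have -> : termA m 0 * - (1 / 8) * P * (n / k%:R) ^+ 3 * (k`!%:R / H k)
      * (k`!%:R * m`!%:R / (m + k)`!%:R)
  = termA m 0 * (- (2^-1 * 2^-1 * 2^-1) * P * (4 ^ k)%:R * ((n / k%:R)
      * ((n / (k%:R * 'C(k.*2, k)%:R)) * (n / (k%:R * 'C(m + k, k)%:R))))).
  have b0 : 'C(k.*2, k)%:R != 0 :> rat by rewrite pnatr_eq0 -lt0n bin_gt0; lia.
  have c0 : 'C(m + k, k)%:R != 0 :> rat by rewrite pnatr_eq0 -lt0n bin_gt0; lia.
  have e0 : 4 ^+ k != 0 :> rat by rewrite expf_neq0.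
  have -> : H k = k`!%:R * 'C(k.*2, k)%:R / 4 ^+ k.
    by rewrite -poch_half_bin [4 ^+ _ * _]mulrC mulfK.
  have -> : (m + k)`!%:R = 'C(m + k, k)%:R * (k`!%:R * m`!%:R) :> rat.
    by rewrite -!natrM -(@bin_fact (m + k) k) ?leq_addl // addnK.
  have k0 : k%:R != 0 :> rat by rewrite pnatr_eq0.
  rewrite natrX; have := factr_neq0 k; have := factr_neq0 m.
  move: e0 b0 c0 k0; move: (4 ^+ k) ('C(k.*2, k)%:R) ('C(m + k, k)%:R) (k`!%:R) (m`!%:R) (k%:R).
  move=> e b c f g x e0 b0 c0 x0 g0 f0.
  by field; rewrite e0 b0 c0 x0 g0 f0.
apply: pdvdM; first exact: termA0_pdvd.
apply: pdvdMl.
  apply: pdvdMl; last exact: pdvd_nat.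
  apply: pdvdMl hP; apply: pdvdN.
  by do 2?[apply: pdvdMl]; exact: pdvd_half.
apply: (@pdvdM p 1 2); first by apply: pdvd_quot; lia.
by apply: (@pdvdM p 1 1); apply: pdvd_leibniz; lia.
Qed.

Lemma termB_termA i : (i <= m)%N -> exists2 u, cong1 p u & termB m i = termA m i * u.
Proof.
elim: i => [|i IH] im.
  by exists 1; rewrite ?termA0 ?termB0 ?mulr1 //; apply: cong1_1.
have [|u hu uE] := IH; first by lia.
(* [w] is (i - n/2) / (i + n/2). At i = 0 this would be -1; only its square matters, so 1 is taken
   instead. *)
pose w : rat := if i == 0%N then 1 else (1 - n / (2 * i%:R)) / (1 + n / (2 * i%:R)).
(* The quotient of the two recurrences: i - 2m - 1/2 = (i + 1/2) - n gives the inverse factor, and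
   (m + 1 + i) / (i - m) = 1 - n / (m - i) the last one. *)
exists (u * (w ^+ 2 * (1 - 2 * (n / i.*2.+1%:R))^-1 * (1 - n / (m - i)%:R))).
  apply: cong1M => //; apply: cong1M; first apply: cong1M.
  - apply: cong1X; rewrite /w; case: eqP => [_|i0]; first exact: cong1_1.
    have hi : (0 < i < p ^ r)%N by lia.
    by apply: cong1M; [apply: cong1_1B | apply/cong1V/cong1_1D => //]; apply: pdvd_half_quot.
  - apply/cong1V/cong1_1B => //; apply: pdvdMl; first exact: (pdvd_nat p 2).
    by apply: pdvd_quot; lia.
  - by apply: cong1_1B; apply: pdvd_quot; lia.
have im' : i%:R < m%:R :> rat by rewrite ltr_nat.
have ige := ler0n rat i.
have wE : (i%:R - m%:R - 1 / 2) ^+ 2 = w ^+ 2 * (i%:R + m%:R + 1 / 2) ^+ 2.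
  rewrite /w; case: eqP => [->|/eqP i0]; first by ring.
  have ipos : 0 < i%:R :> rat by rewrite ltr0n lt0n.
  by rewrite -muln2; field; rewrite !gt_eqF //; lra.
have -> : termB m i.+1 = termB m i * ((i%:R - m%:R - 1 / 2) ^+ 2 * (i%:R - m%:R - 1 / 2)
    / ((i%:R + 1) * (i%:R - 2 * m%:R - 1 / 2) * (i%:R - m%:R))).
  by rewrite termB_rec // -exprSr.
rewrite termA_rec // uE wE natrB; last by lia.
move: (w) (termA m i) => w' T; rewrite -!muln2.
field; do !(apply/andP; split); first [rewrite gt_eqF //; lra | rewrite lt_eqF //; lra].
Qed.

End PrimePower.

Theorem theorem1p3 (p r : nat) (hp : prime p) (hodd : odd p) (hr : (1 <= r)%N) :
  rat_cong_mod p (r + 4)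
    (\sum_(0 <= k < p ^ r)
        (3 * k%:R + 1) * (poch (1/2) k ^+ 3 / poch 1 k ^+ 3) * 4 ^+ k)
    (\sum_(0 <= k < ((p ^ r).-1)./2.+1)
        (4 * k%:R + 1) * (poch (1/2) k ^+ 4 / poch 1 k ^+ 4)).
Proof.
have [m pr] : exists m, (p ^ r = m.*2.+1)%N.
  by exists (p ^ r)./2; rewrite -[LHS]odd_double_half oddX hodd orbT.
apply: rat_cong_modP => //.
rewrite pr /= doubleK sum_A sum_B.
have -> : \sum_(0 <= j < m.+1) (\prod_(l < j) (- (2 * (2 * l%:R + 1))^-1)) * GA m.*2.+1 j
    = \sum_(0 <= i < m.+1) termA m i.
  by rewrite big_nat_rev; apply: eq_bigr => i _; rewrite add0n subSS.
have -> : \sum_(0 <= j < m.+1)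
      (\prod_(l < j) (- 8 * (l%:R + 1) / (2 * l%:R + 1) ^+ 3)) * GB m.+1 j
    = \sum_(0 <= i < m.+1) termB m i.
  by rewrite big_nat_rev; apply: eq_bigr => i _; rewrite add0n subSS.
(* The equal terms at i = 0, divisible by p^r but not shown to be so by more, cancel here. *)
rewrite -sumrB big_nat_recl // termA0 termB0 subrr add0r big_seq_cond.
apply: pdvd_sum => i; rewrite andbT mem_index_iota => /andP [_ im].
have [u hu ->] := termB_termA p r m hp hodd pr i.+1 im.
(* [termA_pdvd] supplies r + 3 factors p, and u - 1 the last one. *)
have -> : termA m i.+1 - termA m i.+1 * u = termA m i.+1 * - (u - 1) by ring.
rewrite -[4%N]/(3 + 1)%N addnA; apply: pdvdM; last exact: pdvdN.
exact: (termA_pdvd p r m hp hodd pr).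
Qed.
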